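(* In the finite scalar protection case with a scheduled action round and independent completion (as in the context), fix a bridging target $y_t>y^-$ whose same-date group $B=B(y_t)$ has $n\ge 1$ members of equal mass $m_B/n$. The group $B$ attempts in one scheduled round starting from the public coalition $C^-$. (i) (Mean condition.) The expected realized public mass is $y^-+(1-\varepsilon)m_B=y_t+\Delta(y_t)$; the mean realized mass is at least $y_t$ exactly when $(1-\varepsilon)\,s(y_t)\ge\varepsilon\,(y_t-y^-)$. (ii) (Concentration.) If $\Delta=\Delta(y_t)>0$, then every member's probability of being unprotected, conditional on her own public action being completed, is at most $\exp(-2n\Delta^2/m_B^2)$, and so is the probability that the realized mass falls short of $y_t$. The call to action is acceptable to every member of $B$ once $n\ge\frac{m_B^2}{2\Delta^2}\ln(1/\underline r)$, where $\underline r=\min_{i\in B}r_i>0$. Along equal-mass refinements ($n\to\infty$) with fixed $m_B$ and fixed $\Delta>0$, the unprotected probability tends to $0$. (iii) (Composition.) If $\Delta(y_t)>0$ and the realized public mass after the round reaches $y_t$, then every member of $B$ who did not become public on her first attempt can try again safely (joining the current public coalition, alone or with others, is protected for her). Once all of $B$ are public, safe expansion by $T$ reaches $C^+$. Thus a public-only composite of the call to action, safe retries, and safe expansion reaches $C^+$ except with probability at most $\exp(-2n\Delta^2/m_B^2)$.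
   Context: Setting. $C_0$ (the vanguard, possibly empty) and $S$ (supporters) are disjoint finite sets; each person $i$ has mass $a_i>0$, $m(C)=\sum_{i\in C}a_i$, $b=m(C_0)$. A coalition is a set $C$ with $C_0\subseteq C\subseteq C_0\cup S$. Scalar protection case: each $i\in C_0\cup S$ has a requirement $\rho_i$, with $\rho_i\le b$ for $i\in C_0$, and a coalition $C\ni i$ protects $i$ (written $C\in\mathcal P_i$) iff $m(C)\ge\rho_i$. $C$ is self-protecting if it protects all its members. $T(C)=C\cup\{i\in S\setminus C: C\cup\{i\}\in\mathcal P_i\}$, $C^-=T^{|S|}(C_0)$, $C^+$ is the union (largest) of all self-protecting coalitions, $y^-=m(C^-)$. For a target $y_t>y^-$: the same-date group is $B(y_t)=\{i\in S\setminus C^-:\rho_i\le y_t\}$; $m_B=m(B(y_t))$; $s(y_t)=y^-+m_B-y_t$; $\Delta(y_t)=(1-\varepsilon)m_B-(y_t-y^-)$. The target is a bridging target if $T^{|S|}(C^-\cup B(y_t))=C^+$. Scheduled action round with independent completion: exactly the members of $B$ attempt to go public in one appointed round; each attempt completes independently with probability $1-\varepsilon\in(0,1)$. If exactly $R\subseteq B$ complete, the public coalition becomes $C^-\cup R$, and a completing participant $i\in R$ is unprotected exactly when $C^-\cup R\notin\mathcal P_i$ (protection is assessed at the end of the round against everyone who completed in it). An attempt that does not complete is costless and reveals no name. In later rounds people can try again, each attempt again completing independently with probability $1-\varepsilon$. The call to action is acceptable to $i$ if her probability of being unprotected, conditional on her own public action being completed, is at most her tolerance $r_i$. In the composite of (iii),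 after a first round with realized mass at least $y_t$, in every subsequent round all not-yet-public supporters in $T(C)\setminus C$ attempt, where $C$ is the current public coalition; ''public-only'' means no private collection of endorsements is used. *)

(* Defs.v *)
From HB Require Import structures.
From mathcomp Require Import all_boot all_order all_algebra.
From mathcomp Require Import finmap.
From mathcomp Require Import all_classical all_reals all_analysis.
Import Order.TTheory GRing.Theory Num.Theory.
Import numFieldNormedType.Exports.

Set Implicit Arguments.
Unset Strict Implicit.
Unset Printing Implicit Defensive.

Local Open Scope ring_scope.

(* [person] may contain people outside [vanguard :|: supporters]; nothing below
   constrains or uses them. *)
Record population (R : realType) := Population {
  person : finType;
  vanguard : {set person};
  supporters : {set person};
  mass : person -> R;
  requirement : person -> R;
  vanguard_supporters_disjoint : [disjoint vanguard & supporters];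
  mass_gt0 : forall i, i \in vanguard :|: supporters -> 0 < mass i;
  vanguard_requirement : forall i, i \in vanguard ->
    requirement i <= \sum_(j in vanguard) mass j }.

Section Coalitions.
Variables (R : realType) (M : population R).
Implicit Types (C : {set person M}) (i : person M) (y : R).

Definition total_mass C : R := \sum_(i in C) mass i.

Definition coalition C : bool :=
  (vanguard M \subset C) && (C \subset vanguard M :|: supporters M).

Definition protects C i : bool := (i \in C) && (requirement i <= total_mass C).

Definition self_protecting C : bool := [forall i in C, protects C i].

Definition expand C : {set person M} :=
  C :|: [set i in supporters M :\: C | protects (i |: C) i]%SET.

Definition expand_all C : {set person M} := iter #|supporters M| expand C.

Definition cminus : {set person M} := expand_all (vanguard M).

Definition cplus : {set person M} :=
  (\bigcup_(C : {set person M} | coalition C && self_protecting C) C)%SET.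

Definition yminus : R := total_mass cminus.

Definition same_date y : {set person M} :=
  [set i in supporters M :\: cminus | requirement i <= y]%SET.

Definition group_mass y : R := total_mass (same_date y).

Definition slack y : R := yminus + group_mass y - y.

Definition margin (eps y : R) : R := (1 - eps) * group_mass y - (y - yminus).

Definition bridging_target y : Prop :=
  expand_all (cminus :|: same_date y) = cplus.

Definition equal_mass_bridging_target y : Prop :=
  [/\ yminus < y, bridging_target y, (0 < #|same_date y|)%N &
      forall i, i \in same_date y ->
        mass i = group_mass y / #|same_date y|%:R].

End Coalitions.
Arguments cminus {R} M.
Arguments cplus {R} M.
Arguments yminus {R} M.
Arguments same_date {R} M y.
Arguments group_mass {R} M y.
Arguments slack {R} M y.
Arguments margin {R} M eps y.
Arguments bridging_target {R} M y.
Arguments equal_mass_bridging_target {R} M y.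

Section Probability.
Variables (R : realType) (d : measure_display) (Omega : measurableType d).
Variable P : probability Omega R.

(* The family of events [E k], for k in [D], is mutually independent. *)
Definition mutually_independent (K : choiceType) (D : {pred K})
    (E : K -> set Omega) : Prop :=
  forall J : {fset K}, {subset J <= D} ->
    P (\bigcap_(k in [set` J]) E k)%classic = (\prod_(k <- J) P (E k))%E.

(* Pr(A | B), for events with P B != 0. *)
Definition cond_prob (A B : set Omega) : R :=
  fine (P (A `&` B)%classic) / fine (P B).

End Probability.

(* [completes t i] is the event that an attempt made by [i] in round [t]
   completes; it only has an effect if [i] does attempt in round [t].
   Round 0 is the scheduled round, rounds 1, 2, ... are the later ones. *)
Record attempts (R : realType) (M : population R) (eps : R) := Attempts {
  disp : measure_display;
  outcome : measurableType disp;
  prob : probability outcome R;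
  completes : nat -> person M -> set outcome;
  completes_measurable : forall t i, i \in supporters M ->
    measurable (completes t i);
  completes_prob : forall t i, i \in supporters M ->
    prob (completes t i) = (1 - eps)%:E;
  completes_independent :
    mutually_independent prob [pred k : nat * person M | k.2 \in supporters M]
      (fun k => completes k.1 k.2) }.

Arguments completes {R M eps} a t i.

Section Rounds.
Variables (R : realType) (M : population R) (eps : R) (X : attempts M eps).
Implicit Types (A C : {set person M}) (i : person M) (t : nat) (y : R).

(* Those among the attempting set [A] who complete in round [t]. *)
Definition completers t A (w : outcome X) : {set person M} :=
  [set i in A | w \in completes X t i]%SET.

Definition first_round y (w : outcome X) : {set person M} :=
  cminus M :|: completers 0 (same_date M y) w.

Definition first_mass y (w : outcome X) : R := total_mass (first_round y w).

Definition completed_first y i : set (outcome X) :=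
  [set w | i \in completers 0 (same_date M y) w]%classic.

Definition unprotected_first y i : set (outcome X) :=
  [set w | i \in completers 0 (same_date M y) w /\
           ~~ protects (first_round y w) i]%classic.

Definition unprotected_prob y i : R :=
  cond_prob (prob X) (unprotected_first y i) (completed_first y i).

Definition acceptable y (r : person M -> R) i : Prop :=
  unprotected_prob y i <= r i.

(* Public coalition after round [t] of the composite. If the scheduled round
   falls short of the target, no later round takes place. *)
Fixpoint composite y t (w : outcome X) : {set person M} :=
  if t is t'.+1 then
    let C := composite y t' w in
    if y <= first_mass y w then C :|: completers t (expand C :\: C) w else C
  else first_round y w.

Definition composite_reaches_cplus y : set (outcome X) :=
  [set w | exists t, composite y t w = cplus M]%classic.

End Rounds.
Arguments first_mass {R M eps} X y w.
Arguments first_round {R M eps} X y w.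
Arguments unprotected_prob {R M eps} X y i.
Arguments acceptable {R M eps} X y r i.
Arguments composite {R M eps} X y t w.
Arguments composite_reaches_cplus {R M eps} X y.
Arguments completers {R M eps} X t A w.

Definition is_min_over (R : realType) (I : finType) (A : {set I}) (f : I -> R)
    (m : R) : Prop :=
  (exists2 i, i \in A & f i = m) /\ (forall i, i \in A -> m <= f i).

(* Main.v *)
(** With [count] the number of completions in the round and p = 1 - eps, the
    first mass is below y exactly when count < n (p - delta), delta = Delta / mB.
    Bounding the indicator of this event by exp (t (n (p - delta) - count)) and
    expanding exp (- t count) = prod_i (1 + (exp (- t) - 1) 1_i) reduces its
    probability, by independence, to the Bernoulli moment generating function,
    which Hoeffding's lemma controls; t = 4 delta gives exp (- 2 n delta^2).
    Conditioning on the completion of i replaces the factor of i by exp (- t),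
    which is smaller than its mean.

    Once y is reached, every coalition met afterwards has mass at least y, so
    all of B stays invited. Almost surely every supporter completes in infinitely
    many rounds, hence the public coalition, which is nondecreasing, can only
    become stationary at a fixed point of the expansion containing C^- and B;
    the bridging hypothesis makes this fixed point equal to C^+. *)

Require Import Defs.
From HB Require Import structures.
From mathcomp Require Import all_boot all_order all_algebra.
From mathcomp Require Import finmap.
From mathcomp Require Import all_classical all_reals all_analysis.
From mathcomp Require Import ring lra.
Import Order.TTheory GRing.Theory Num.Theory.
Import numFieldNormedType.Exports.

Set Implicit Arguments.
Unset Strict Implicit.
Unset Printing Implicit Defensive.

Local Open Scope ring_scope.

(** * Coalitions and safe expansion *)

Section Coalitions.
Variables (R : realType) (M : population R).
Implicit Types (C D : {set person M}) (i : person M) (y : R).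

Local Notation everyone := (vanguard M :|: supporters M).
(* all_analysis also exports an [expand], which shadows the one of Defs. *)
Local Notation expand := (@Defs.expand R M).

(** Masses are only assumed positive on [everyone], hence the recurring requirement that the larger
    set lie inside it. *)
Lemma total_mass_subset C D :
  C \subset D -> D \subset everyone -> total_mass C <= total_mass D.
Proof.
move=> CD DS; rewrite /total_mass [leRHS](big_setID C)/=.
rewrite (finset.setIidPr CD) lerDl.
apply: sumr_ge0 => i; rewrite finset.inE => /andP[_ iD].
by apply/ltW/mass_gt0/(fintype.subsetP DS).
Qed.

Lemma protects_subset C D i :
  C \subset D -> D \subset everyone -> protects C i -> protects D i.
Proof.
move=> CD DS /andP[iC hi]; rewrite /protects (fintype.subsetP CD) //=.
exact: le_trans hi (total_mass_subset CD DS).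
Qed.

Lemma subset_expand C : C \subset expand C.
Proof. exact: finset.subsetUl. Qed.

Lemma expand_everyone C : C \subset everyone -> expand C \subset everyone.
Proof.
move=> CS; rewrite finset.subUset CS; apply/fintype.subsetP => i.
by rewrite !finset.inE => /andP[/andP[_ ->]]; rewrite orbT.
Qed.

Lemma expandS C D :
  C \subset D -> D \subset everyone -> expand C \subset expand D.
Proof.
move=> CD DS; apply/fintype.subsetP => i; rewrite !finset.inE.
case/orP=> [/(fintype.subsetP CD)->//|/andP[/andP[_ iS] pi]].
have [//|iD /=] := boolP (i \in D); rewrite iS /=.
apply: protects_subset pi; first exact: finset.setUS.
by rewrite finset.subUset DS finset.sub1set finset.inE iS orbT.
Qed.

Lemma subset_expand_all C : C \subset expand_all C.
Proof.
rewrite /expand_all; elim: #|_| => //= n IHn.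
exact: fintype.subset_trans IHn (subset_expand _).
Qed.

Lemma expand_all_everyone C :
  C \subset everyone -> expand_all C \subset everyone.
Proof.
move=> CS; rewrite /expand_all; elim: #|_| => //= n IHn.
exact: expand_everyone.
Qed.

Lemma expand_allS C D :
  C \subset D -> D \subset everyone -> expand_all C \subset expand_all D.
Proof.
move=> CD DS; rewrite /expand_all; set n := #|_|.
suff: (iter n expand C \subset iter n expand D) &&
    (iter n expand D \subset everyone) by case/andP.
elim: n => /= [|n /andP[IH IHS]]; first by rewrite CD.
by rewrite expandS ?expand_everyone.
Qed.

Lemma expand_all_fixed C : expand C = C -> expand_all C = C.
Proof. by move=> e; rewrite /expand_all; elim: #|_| => //= n ->. Qed.

Lemma coalition_cplus : coalition (cplus M).
Proof.
apply/andP; split.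
  apply/fintype.subsetP => i iV; apply/bigcupP; exists (vanguard M) => //.
  rewrite /coalition subxx finset.subsetUl /=; apply/forall_inP => j jV.
  by rewrite /protects jV; apply: vanguard_requirement.
by apply/bigcupsP => C /andP[/andP[]].
Qed.

Lemma cplus_everyone : cplus M \subset everyone.
Proof. by have /andP[] := coalition_cplus. Qed.

Lemma subset_cplus C : coalition C -> self_protecting C -> C \subset cplus M.
Proof. by move=> cC sC; apply: finset.bigcup_sup; rewrite cC. Qed.

(** Each member of the union is protected by one of the united coalitions, and protection survives
    enlargement because it is a lower bound on mass. *)
Lemma self_protecting_cplus : self_protecting (cplus M).
Proof.
apply/forall_inP => i /bigcupP[C /andP[cC sC] iC].
by apply: (protects_subset (subset_cplus cC sC) cplus_everyone);
  apply: (forall_inP sC).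
Qed.

(** A supporter protected on joining C^+ would turn it into a self-protecting coalition, which is
    already contained in the union C^+. *)
Lemma expand_cplus : expand (cplus M) = cplus M.
Proof.
apply/eqP; rewrite finset.eqEsubset subset_expand andbT finset.subUset subxx.
apply/fintype.subsetP => i; rewrite !finset.inE => /andP[/andP[_ iS] pi].
have iE : i |: cplus M \subset everyone.
  by rewrite finset.subUset cplus_everyone finset.sub1set finset.inE iS orbT.
apply: (fintype.subsetP (subset_cplus (C := i |: cplus M) _ _));
  last exact: finset.setU11.
  have /andP[VC _] := coalition_cplus.
  by rewrite /coalition iE (fintype.subset_trans VC (finset.subsetUr _ _)).
apply/forall_inP => j; rewrite finset.in_setU1 => /predU1P[->//|jC].
by apply: (protects_subset (finset.subsetUr _ _) iE);
  apply: (forall_inP self_protecting_cplus).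
Qed.

Lemma expand_sub_cplus C : C \subset cplus M -> expand C \subset cplus M.
Proof. by move=> /expandS -/(_ cplus_everyone); rewrite expand_cplus. Qed.

Lemma expand_all_sub_cplus C :
  C \subset cplus M -> expand_all C \subset cplus M.
Proof.
move=> /expand_allS -/(_ cplus_everyone).
by rewrite (expand_all_fixed expand_cplus).
Qed.

Lemma cminus_everyone : cminus M \subset everyone.
Proof. exact: expand_all_everyone (finset.subsetUl _ _). Qed.

Lemma same_date_supporters y : same_date M y \subset supporters M.
Proof.
by apply/fintype.subsetP => i; rewrite !finset.inE => /andP[/andP[]].
Qed.

Lemma same_date_requirement y i : i \in same_date M y -> requirement i <= y.
Proof. by rewrite finset.inE => /andP[]. Qed.

Lemma disjoint_cminus_same_date y : [disjoint cminus M & same_date M y].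
Proof.
rewrite disjoint_subset; apply/fintype.subsetP => i iC; rewrite !finset.inE.
by rewrite iC.
Qed.

Lemma total_mass_setU C D :
  [disjoint C & D] -> total_mass (C :|: D) = total_mass C + total_mass D.
Proof.
move=> CD; rewrite /total_mass -bigU //.
by apply: eq_bigl => i; rewrite !finset.inE.
Qed.

Lemma bridging_sub_cplus y :
  bridging_target M y -> cminus M :|: same_date M y \subset cplus M.
Proof. by move=> <-; exact: subset_expand_all. Qed.

(** Monotonicity squeezes the expansion of [C] between that of C^- with B, which is C^+ by bridging,
    and that of C^+, a fixed point. *)
Lemma bridging_expand_all y C : bridging_target M y ->
  cminus M :|: same_date M y \subset C -> C \subset cplus M ->
  expand_all C = cplus M.
Proof.
move=> hb BC CP; apply/eqP; rewrite finset.eqEsubset expand_all_sub_cplus //=.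
by rewrite -{1}hb expand_allS ?(fintype.subset_trans CP) ?cplus_everyone.
Qed.

Lemma same_date_protected y C i :
  i \in same_date M y -> C \subset everyone -> i \in C ->
  y <= total_mass C -> protects C i.
Proof.
move=> iB CS iC yC; rewrite /protects iC /=.
exact: le_trans (same_date_requirement iB) yC.
Qed.

End Coalitions.

(** * Tail bounds for independent events *)

Section BernoulliMgf.
Variables (R : realType) (p : R).
Hypothesis p01 : 0 < p < 1.

Let q_gt0 : 0 < 1 - p. Proof. by case/andP: p01; rewrite subr_gt0. Qed.
Let p_gt0 : 0 < p. Proof. by case/andP: p01. Qed.

(** For a Bernoulli variable of parameter p, [excess s] is its moment generating function at -s
    divided by Hoeffding's bound exp (- s p + s^2 / 8), and [den s] is e^s times that generating
    function. *)
Let den (s : R) := (1 - p) * expR s + p.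
Let slope (s : R) := p - s / 4 - p / den s.
Let excess (s : R) := (1 - p + p * expR (- s)) * expR (s * p - s ^+ 2 / 8).

Let den_gt0 s : 0 < den s.
Proof. by rewrite addr_gt0 ?mulr_gt0 ?expR_gt0. Qed.

Let den_is_derive (s : R) : is_derive s 1 den ((1 - p) * expR s).
Proof.
by apply: is_derive_eq; rewrite /GRing.scale /= addr0.
Qed.

Let slope_is_derive (s : R) : is_derive s 1 slope
  (- 4^-1 + p * (1 - p) * expR s / den s ^+ 2).
Proof.
have d0 := lt0r_neq0 (den_gt0 s).
have dV := is_deriveV d0 (den_is_derive s).
apply: is_derive_eq; rewrite /GRing.scale /=.
by field.
Qed.

Let excess_is_derive (s : R) : is_derive s 1 excess
  (expR (s * p - s ^+ 2 / 8) * (1 - p + p * expR (- s)) * slope s).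
Proof.
have d0 := lt0r_neq0 (den_gt0 s).
have dX : is_derive s 1 (fun x : R => x * p - x ^+ 2 / 8) (p - s / 4).
  by apply: is_derive_eq; rewrite /GRing.scale /=; field.
have dE := is_derive1_comp (is_derive_expR _) dX.
have dN :
    is_derive s 1 (fun x : R => 1 - p + p * expR (- x)) (- p * expR (- s)).
  by apply: is_derive_eq; rewrite /GRing.scale /=; ring.
have -> : excess = (fun x : R => 1 - p + p * expR (- x)) *
  (expR \o (fun x : R => x * p - x ^+ 2 / 8)) by [].
apply: is_derive_eq; rewrite /GRing.scale /=.
(* Writing exp (- s) as an inverse makes the identity rational in exp s. *)
move: d0; rewrite /slope /den expRN => d0; field.
by rewrite d0 (lt0r_neq0 (expR_gt0 _)).
Qed.

Let nonincreasing_le (f df : R -> R) (s : R) :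
  (forall x : R, is_derive x 1 f (df x)) -> (forall x, 0 < x -> df x <= 0) ->
  0 <= s -> f s <= f 0.
Proof.
move=> fD df0 s0; apply: (@ler0_derive1_nincr R f 0 s) => //.
- by move=> x /[!in_itv]/= /andP[x0 _]; rewrite derive1E derive_val df0.
- apply: continuous_subspaceT => x.
  by apply: differentiable_continuous; apply/derivable1_diffP.
Qed.

Let slope_le0 (s : R) : 0 <= s -> slope s <= 0.
Proof.
have slope0 : slope 0 = 0.
  by rewrite /slope /den expR0 mulr1 subrK divr1 mul0r subr0 subrr.
move=> s0; apply: le_trans (nonincreasing_le slope_is_derive _ s0) _;
  last by rewrite slope0.
move=> x _.
rewrite addrC subr_le0 ler_pdivrMr ?exprn_gt0 // /den.
(* This square is exactly den^2 - 4 p (1 - p) e^x. *)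
by have := sqr_ge0 ((1 - p) * expR x - p); lra.
Qed.

(* Hoeffding's lemma: the logarithmic derivative of [excess] is [slope], and
   [slope] decreases from 0 because p q e^s <= (q e^s + p)^2 / 4. *)
Lemma bernoulli_mgf_le (s : R) : 0 <= s ->
  1 + (expR (- s) - 1) * p <= expR (- (s * p) + s ^+ 2 / 8).
Proof.
move=> s0.
have : excess s <= excess 0.
  apply: (nonincreasing_le excess_is_derive) s0 => x x0.
  rewrite mulr_ge0_le0 ?slope_le0 ?(ltW x0) // mulr_ge0 ?expR_ge0 //.
  by rewrite addr_ge0 ?mulr_ge0 ?expR_ge0 // ltW.
rewrite /excess oppr0 expR0 mul0r expr0n/= mul0r subr0 expR0 !mulr1 subrK.
move=> excess_le1.
have -> : - (s * p) + s ^+ 2 / 8 = - (s * p - s ^+ 2 / 8) by ring.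
have -> : 1 + (expR (- s) - 1) * p = 1 - p + p * expR (- s) by ring.
by rewrite [leRHS]expRN -[leRHS]div1r ler_pdivlMr ?expR_gt0.
Qed.

End BernoulliMgf.

Lemma prodr_seq_eq (R : comPzRingType) (K : eqType) (s : seq K) (f : K -> R) x :
  {in s, forall k, f k = x} -> \prod_(k <- s) f k = x ^+ size s.
Proof.
elim: s => [|k s IHs] fx; first by rewrite big_nil.
rewrite big_cons fx ?mem_head // IHs ?exprS // => l ls.
by rewrite fx // in_cons ls orbT.
Qed.

(** * Exponential bounds for mutually independent events *)

Section IndependentEvents.
Variables (R : realType) (d : measure_display) (Omega : measurableType d).
Variables (P : probability Omega R) (K : choiceType) (D : {pred K}).
Variable E : K -> set Omega.
Hypothesis mE : forall k, k \in D -> measurable (E k).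
Hypothesis indepE : mutually_independent P D E.
Implicit Types (J : {fset K}) (s : seq K) (a c : K -> R).

Local Notation pr k := (fine (P (E k))).
Local Notation meet J := (\bigcap_(k in [set` J]) E k)%classic.

Lemma measurable_meet J : {subset J <= D} -> measurable (meet J).
Proof.
move=> JD; apply: fin_bigcap_measurable; first exact: finite_fset.
by move=> k /= kJ; apply/mE/JD.
Qed.

Lemma prob_meet J :
  {subset J <= D} -> P (meet J) = (\prod_(k <- J) pr k)%:E.
Proof.
move=> JD; rewrite indepE // -prodEFin big_seq [RHS]big_seq.
apply: eq_bigr => k kJ; rewrite fineK // fin_num_measure //.
by apply/mE/JD.
Qed.

(* Expanding the product one factor at a time only involves intersections of
   the events, never complements, so independence applies as it stands. *)
Lemma integral_prod_affine_indic J s a c :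
  {subset J <= D} -> {subset s <= D} -> uniq s ->
  {in s, forall k, k \notin J} ->
  let f w := \1_(meet J) w * \prod_(k <- s) (a k + c k * \1_(E k) w) in
  P.-integrable setT (EFin \o f) /\
  (\int[P]_w (f w)%:E)%E =
    (\prod_(k <- J) pr k * \prod_(k <- s) (a k + c k * pr k))%:E.
Proof.
elim: s J => [|k s IHs] J JD sD us sJ f.
  have fE : EFin \o f = EFin \o \1_(meet J).
    by apply/funext => w /=; rewrite /f big_nil mulr1.
  rewrite fE; split; first exact/integrable_indic/measurable_meet.
  have -> : (\int[P]_w (f w)%:E = \int[P]_w (\1_(meet J) w)%:E)%E.
    by apply: eq_integral => w _; rewrite /f big_nil mulr1.
  rewrite integral_indic //; last exact: measurable_meet.
  by rewrite setIT big_nil mulr1; exact: prob_meet.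
have kD : k \in D by apply: sD; rewrite mem_head.
have kJ : k \notin J by apply: sJ; rewrite mem_head.
case/andP: us => ks us.
have JkD : {subset (k |` J)%fset <= D}.
  by move=> l; rewrite !inE => /orP[/eqP->|/JD].
have sD' : {subset s <= D} by move=> l ls; apply: sD; rewrite in_cons ls orbT.
have sJ' : {in s, forall l, l \notin J}.
  by move=> l ls; apply: sJ; rewrite in_cons ls orbT.
have sJk : {in s, forall l, l \notin (k |` J)%fset}.
  move=> l ls; rewrite !inE negb_or sJ' // andbT.
  by apply: contraNneq ks => <-.
have [i1 e1] := IHs J JD sD' us sJ'.
have [i2 e2] := IHs (k |` J)%fset JkD sD' us sJk.
have meetU w : \1_(meet (k |` J)%fset) w = \1_(E k) w * \1_(meet J) w :> R.
  by rewrite set_fsetU1 bigcap_setU1 indicI.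
set g := fun w => \1_(meet J) w * \prod_(l <- s) (a l + c l * \1_(E l) w).
set h := fun w => \1_(meet (k |` J)%fset) w *
  \prod_(l <- s) (a l + c l * \1_(E l) w).
(* Distributing the factor of [k], the constant part keeps [J] and the indicator part moves [k] into
   [J]; this is why the induction generalizes over [J]. *)
have fE w : ((f w)%:E = (a k)%:E * (g w)%:E + (c k)%:E * (h w)%:E)%E.
  by rewrite -!EFinM -EFinD /f /g /h meetU big_cons; congr EFin; ring.
have ig : P.-integrable setT (fun w => (a k)%:E * (g w)%:E)%E.
  exact: integrableZl.
have ih : P.-integrable setT (fun w => (c k)%:E * (h w)%:E)%E.
  exact: integrableZl.
split.
  have -> : EFin \o f = ((fun w => (a k)%:E * (g w)%:E) \+
      (fun w => (c k)%:E * (h w)%:E))%E by apply/funext => w; exact: fE.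
  exact: integrableD.
transitivity (\int[P]_w ((a k)%:E * (g w)%:E + (c k)%:E * (h w)%:E))%E.
  by apply: eq_integral => w _; exact: fE.
rewrite integralD // !integralZl // e1 e2 -!EFinM -EFinD big_cons.
by rewrite big_fsetU1 //=; congr EFin; ring.
Qed.

(** Markov's inequality in product form: the indicator of [A] is integrated against a majorant whose
    integral factors. The Hoeffding tails and the bound on never completing both come from it. *)
Lemma prob_le_prod_affine J s a c (A : set Omega) (x : R) :
  measurable A -> {subset J <= D} -> {subset s <= D} -> uniq s ->
  {in s, forall k, k \notin J} ->
  (forall w, \1_A w <= x *
    (\1_(meet J) w * \prod_(k <- s) (a k + c k * \1_(E k) w))) ->
  (P A <= (x * (\prod_(k <- J) pr k * \prod_(k <- s) (a k + c k * pr k)))%:E)%E.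
Proof.
move=> mA JD sD us sJ Ale.
have /= [intf ef] := integral_prod_affine_indic a c JD sD us sJ.
rewrite EFinM -ef -integralZl //.
have -> : P A = (\int[P]_w (\1_A w)%:E)%E by rewrite integral_indic ?setIT.
apply: le_integral => //; first exact: integrable_indic.
  exact: integrableZl.
by move=> w _; rewrite -EFinM lee_fin Ale.
Qed.

Section EqualProbability.
Variable p : R.
Hypothesis p01 : 0 < p < 1.
Hypothesis Ep : forall k, k \in D -> P (E k) = p%:E.

(** Chernoff bound with majorant exp (t (x - count)). The events of [J] are forced to hold on [A],
    so each contributes a factor p instead of a generating function. *)
Lemma prob_lower_tail_le J s (A : set Omega) (x t : R) :
  measurable A -> {subset J <= D} -> {subset s <= D} -> uniq s ->
  {in s, forall k, k \notin J} -> 0 <= t ->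
  (forall w, A w ->
    {in J, forall k, E k w} /\ \sum_(k <- s) \1_(E k) w <= x) ->
  (P A <= (p ^+ #|` J| *
    (expR (t * x) * (1 + (expR (- t) - 1) * p) ^+ size s))%:E)%E.
Proof.
move=> mA JD sD us sJ t0 AP.
have -> : p ^+ #|` J| * (expR (t * x) * (1 + (expR (- t) - 1) * p) ^+ size s) =
   expR (t * x) * (\prod_(k <- J) pr k *
     \prod_(k <- s) (1 + (expR (- t) - 1) * pr k)).
  have prE k : k \in D -> pr k = p by move=> kD; rewrite Ep.
  rewrite (prodr_seq_eq (x := p)) => [|k /JD/prE //].
  rewrite (prodr_seq_eq (x := 1 + (expR (- t) - 1) * p)) => [|k /sD/prE -> //].
  by ring.
apply: prob_le_prod_affine => // w.
(* An indicator takes only the values 0 and 1, so the exponential of its multiple is affine in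
   it. *)
have prod_expR : \prod_(k <- s) (1 + (expR (- t) - 1) * \1_(E k) w) =
    expR (- (t * \sum_(k <- s) \1_(E k) w)).
  rewrite mulr_sumr -sumrN expR_sum; apply: eq_bigr => k _.
  rewrite indicE; case: (w \in E k); first by rewrite !mulr1; ring.
  by rewrite !mulr0 oppr0 expR0 addr0.
rewrite prod_expR [leLHS]indicE; have [/set_mem Aw|_] := boolP (w \in A).
  have [JE le_x] := AP w Aw.
  rewrite indicE mem_set /=; last by move=> k /JE.
  by rewrite mul1r -expRD -mulrN -mulrDr -expR0 ler_expR mulr_ge0 // subr_ge0.
by rewrite !mulr_ge0 ?expR_ge0 // indicE.
Qed.

(* The choice t = 4 delta is optimal in the quadratic Hoeffding exponent. *)
Lemma hoeffding_exponent_le n (delta : R) : 0 <= delta ->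
  expR (4 * delta * (n%:R * (p - delta))) *
    (1 + (expR (- (4 * delta)) - 1) * p) ^+ n <=
  expR (- (2 * n%:R * delta ^+ 2)).
Proof.
move=> d0; have d40 : 0 <= 4 * delta by rewrite mulr_ge0.
have m0 : 0 <= 1 + (expR (- (4 * delta)) - 1) * p.
  by have := expR_ge0 (- (4 * delta)); case/andP: p01 => p0 p1 e0; nra.
apply: (@le_trans _ _ (expR (4 * delta * (n%:R * (p - delta))) *
   expR (- (4 * delta * p) + (4 * delta) ^+ 2 / 8) ^+ n)).
  by rewrite ler_wpM2l ?expR_ge0 // lerXn2r ?nnegrE ?expR_ge0 ?bernoulli_mgf_le.
(* The exponents add up to n (- 4 delta^2 + 2 delta^2). *)
rewrite -expRM_natl -expRD ler_expR -mulr_natl.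
by rewrite le_eqVlt; apply/orP; left; apply/eqP; field.
Qed.

Lemma binomial_lower_tail s (A : set Omega) (delta : R) :
  measurable A -> {subset s <= D} -> uniq s -> 0 <= delta ->
  (forall w, A w ->
    \sum_(k <- s) \1_(E k) w <= (size s)%:R * (p - delta)) ->
  (P A <= (expR (- (2 * (size s)%:R * delta ^+ 2)))%:E)%E.
Proof.
move=> mA sD us d0 AP.
have d40 : 0 <= 4 * delta by rewrite mulr_ge0.
have := @prob_lower_tail_le fset0 s A
  ((size s)%:R * (p - delta)) (4 * delta) mA.
rewrite cardfs0 expr0 mul1r => /(_ _ sD us _ d40) tail.
apply: le_trans (tail _ _ _) _ => // [w /AP //|].
by rewrite lee_fin hoeffding_exponent_le.
Qed.

(** Dividing by p = P (E k) bounds the probability conditional on [E k] by the unconditional tail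
    bound. *)
Lemma binomial_lower_tail_joint k s (A : set Omega) (delta : R) :
  measurable A -> {subset s <= D} -> uniq s -> k \in s -> 0 <= delta ->
  (forall w, A w -> E k w /\
    \sum_(l <- s) \1_(E l) w <= (size s)%:R * (p - delta)) ->
  (P A <= (p * expR (- (2 * (size s)%:R * delta ^+ 2)))%:E)%E.
Proof.
move=> mA sD us ks d0 AP.
have d40 : 0 <= 4 * delta by rewrite mulr_ge0.
set x := (size s)%:R * (p - delta).
have sizes : size s = (size (rem k s)).+1.
  by rewrite size_rem ?prednK; case: (s) ks.
(* [E k] accounts for one unit of the count, which leaves x - 1 for the other events. *)
have := @prob_lower_tail_le [fset k]%fset (rem k s) A (x - 1) (4 * delta) mA.
rewrite cardfs1 expr1 => /(_ _ _ (rem_uniq _ us) _ d40) tail.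
apply: le_trans (tail _ _ _ _) _.
- by move=> l /[!inE] /eqP ->; exact: sD.
- by move=> l /mem_rem; exact: sD.
- by move=> l; rewrite mem_rem_uniq // !inE => /andP[].
- move=> w /AP[Ekw]; rewrite (perm_big _ (perm_to_rem ks)) big_cons /=.
  rewrite indicE mem_set //= => le_x; split; last by rewrite lerBrDl.
  by move=> l /[!inE] /eqP ->.
rewrite lee_fin ler_wpM2l //; first by case/andP: p01 => /ltW.
apply: (le_trans _ (hoeffding_exponent_le (size s) d0)).
rewrite sizes exprS mulrA ler_wpM2r //.
  rewrite exprn_ge0 //.
  by have := expR_ge0 (- (4 * delta)); case/andP: p01 => p0 p1 e0; nra.
have -> : expR (4 * delta * (x - 1)) =
    expR (4 * delta * x) * expR (- (4 * delta)).
  by rewrite -expRD; congr expR; ring.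
rewrite -sizes ler_wpM2l ?expR_ge0 //.
(* The unit taken off the count costs a factor e = exp (- 4 delta), and 1 + (e - 1) p - e = (1 - e)
   (1 - p) is nonnegative. *)
have : expR (- (4 * delta)) <= 1 by rewrite -[leRHS]expR0 ler_expR oppr_le0.
by case/andP: p01 => p0 p1 e1; nra.
Qed.

(** The indicator of a complement is affine in that of the event, with coefficients 1 and -1, so the
    complements need no independence statement of their own. *)
Lemma prob_none_le s (A : set Omega) :
  measurable A -> {subset s <= D} -> uniq s ->
  (forall w, A w -> {in s, forall k, ~ E k w}) ->
  (P A <= ((1 - p) ^+ size s)%:E)%E.
Proof.
move=> mA sD us AP.
have := @prob_le_prod_affine fset0 s (fun=> 1) (fun=> -1) A 1 mA.
move=> /(_ _ sD us) tail; apply: le_trans (tail _ _ _) _ => //.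
  move=> w; rewrite mul1r.
  have prod_ge0 : 0 <= \prod_(k <- s) (1 + -1 * \1_(E k) w) :> R.
    by apply: prodr_ge0 => k _; rewrite indicE mulN1r subr_ge0 lern1 leq_b1.
  rewrite indicE; have [/set_mem Aw|_] := boolP (w \in A); last first.
    by rewrite mulr_ge0 // indicE.
  rewrite indicE mem_set ?mul1r //=.
  rewrite big_seq big1 // => k ks.
  by rewrite indicE memNset ?mulr0 ?addr0 //; exact: AP.
rewrite mul1r lee_fin big_seq_fset0 mul1r (prodr_seq_eq (x := 1 - p)) //.
by move=> k ks; rewrite Ep ?mulN1r //; exact: sD.
Qed.

End EqualProbability.
End IndependentEvents.

(** * The composite protocol *)

Section FiniteRange.
Variables (d : measure_display) (Omega : measurableType d).

(** Measurability for the discrete sigma-algebra on [T], expressed through predicates so that random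
    coalitions need no measurable structure on their type. *)
Definition finitely_measurable (T : finType) (f : Omega -> T) : Prop :=
  forall Q : pred T, measurable [set w | Q (f w)]%classic.

Lemma finitely_measurableP (T : finType) (f : Omega -> T) :
  (forall x, measurable [set w | f w = x]%classic) -> finitely_measurable f.
Proof.
move=> mf Q.
rewrite (_ : mkset _ = \bigcup_(x in [set x | Q x]) [set w | f w = x])%classic.
  apply: fin_bigcup_measurable => // x _; exact: mf.
by apply/seteqP; split => w /= => [Qw|[x Qx ->//]]; exists (f w).
Qed.

Lemma finitely_measurable_comp2 (T1 T2 T3 : finType) (h : T1 -> T2 -> T3) f g :
  finitely_measurable f -> finitely_measurable g ->
  finitely_measurable (fun w => h (f w) (g w)).
Proof.
move=> mf mg Q.
rewrite (_ : mkset _ = \bigcup_(x in setT)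
   ([set w | f w == x] `&` [set w | Q (h x (g w))]))%classic.
  apply: fin_bigcup_measurable => [|x _]; first exact: finite_finset.
  apply: measurableI; first exact: (mf (pred1 x)).
  exact: (mg (fun z => Q (h x z))).
apply/seteqP; split => w /= => [Qw|[x _ [/eqP -> //]]].
by exists (f w) => //; split => //=.
Qed.

End FiniteRange.

(** From a time at which the cardinality is maximal, inclusion forces equality. *)
Lemma nondecreasing_set_stationary (T : finType) (C : nat -> {set T}) :
  (forall t, C t \subset C t.+1) ->
  exists t0, forall t, (t0 <= t)%N -> C t = C t0.
Proof.
move=> CS.
have Cmono t u : (t <= u)%N -> C t \subset C u.
  move=> /subnK <-; elim: (u - t)%N => // m IHm.
  exact: fintype.subset_trans IHm (CS _).
have ex_card : exists n, `[< exists t, #|C t| = n >].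
  by exists #|C 0%N|; apply/asboolP; exists 0%N.
have card_le n : `[< exists t, #|C t| = n >] -> (n <= #|T|)%N.
  by move=> /asboolP[t <-]; exact: max_card.
case: (ex_maxnP ex_card card_le) => n /asboolP[t0 <-] t0_max.
exists t0 => t t0t; apply/eqP; rewrite eq_sym eqEcard Cmono //=.
by apply: t0_max; apply/asboolP; exists t.
Qed.

(** * Measurability and almost sure limit of the composite *)

Section Rounds.
Variables (R : realType) (M : population R) (eps : R) (X : attempts M eps).
Implicit Types (A C : {set person M}) (i : person M) (t : nat) (y : R).

Local Notation expand := (@Defs.expand R M).
Local Notation everyone := (vanguard M :|: supporters M).
Local Notation P := (prob X).

Lemma measurable_completers t A : A \subset supporters M ->
  finitely_measurable (completers X t A).
Proof.
move=> AS; apply: finitely_measurableP => C.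
rewrite (_ : mkset _ = \bigcap_(i in setT)
   [set w | (i \in completers X t A w) = (i \in C)])%classic; last first.
  apply/seteqP; split => [w <- //|w /= wC].
  by apply/setP => i; exact: wC.
apply: fin_bigcap_measurable => [|i _]; first exact: finite_finset.
have [iA|iA] := boolP (i \in A).
  have mi := completes_measurable X t (fintype.subsetP AS _ iA).
  have -> : [set w | (i \in completers X t A w) = (i \in C)]%classic =
      (if i \in C then completes X t i else ~` completes X t i)%classic.
    by apply/seteqP; split => w /=; rewrite finset.in_set iA; case: (i \in C);
      [exact: set_mem | move=> h; apply: contraFnot h; exact: mem_set
      | exact: mem_set | exact: memNset].
  by case: (i \in C) => //; exact: measurableC.
have -> : [set w | (i \in completers X t A w) = (i \in C)]%classic =
    (if i \in C then set0 else setT)%classic.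
  by apply/seteqP; split => w /=; rewrite finset.in_set (negbTE iA);
    case: (i \in C).
by case: (i \in C).
Qed.

(** In later rounds the attempting set is itself random; this separates it from the completions,
    taken over the fixed set of all supporters. *)
Lemma completers_setI t A w : A \subset supporters M ->
  completers X t A w = A :&: completers X t (supporters M) w.
Proof.
move=> AS; apply/setP => i; rewrite !finset.inE.
by case iA: (i \in A) => //=; rewrite (fintype.subsetP AS).
Qed.

Lemma completers_subset t A w : completers X t A w \subset A.
Proof. by apply/fintype.subsetP => i; rewrite finset.inE => /andP[]. Qed.

Lemma joining_supporters C : expand C :\: C \subset supporters M.
Proof.
apply/fintype.subsetP => i; rewrite !finset.inE.
by case: (i \in C) => //= /andP[].
Qed.

Lemma measurable_first_round y : finitely_measurable (first_round X y).
Proof.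
have mB := measurable_completers 0 (same_date_supporters M y).
by move=> Q; exact: (mB (fun B => Q (cminus M :|: B))).
Qed.

Lemma measurable_composite y t : finitely_measurable (composite X y t).
Proof.
elim: t => [|t IHt]; first exact: measurable_first_round.
(* The first component remembers the scheduled round, whose mass decides whether later rounds take
   place. *)
pose step (C0C : {set person M} * {set person M}) (G : {set person M}) :=
  if y <= total_mass C0C.1 then C0C.2 :|: ((expand C0C.2 :\: C0C.2) :&: G)
  else C0C.2.
have -> : composite X y t.+1 = (fun w =>
    step (first_round X y w, composite X y t w)
      (completers X t.+1 (supporters M) w)).
  by apply/funext => w; rewrite /= completers_setI ?joining_supporters.
apply: (finitely_measurable_comp2 step); last exact: measurable_completers.
apply: (finitely_measurable_comp2 pair) => //.
exact: measurable_first_round.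
Qed.

Lemma measurable_composite_reaches_cplus y :
  measurable (composite_reaches_cplus X y).
Proof.
rewrite (_ : composite_reaches_cplus X y =
   \bigcup_t [set w | composite X y t w == cplus M])%classic.
  apply: bigcup_measurable => t _.
  exact: (measurable_composite y t (pred1 _)).
by apply/seteqP; split => w [t]; [move=> /eqP|move=> _ /eqP]; exists t.
Qed.

Lemma measurable_first_mass_lt y :
  measurable [set w | first_mass X y w < y]%classic.
Proof. exact: (measurable_first_round y (fun C => total_mass C < y)). Qed.

Lemma composite_mono y t w : composite X y t w \subset composite X y t.+1 w.
Proof. by rewrite /=; case: ifP => // _; exact: finset.subsetUl. Qed.

Lemma first_round_composite y t w : first_round X y w \subset composite X y t w.
Proof.
elim: t => // t IHt; exact: fintype.subset_trans IHt (composite_mono _ _ _).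
Qed.

Lemma composite_joining y t w :
  composite X y t.+1 w \subset expand (composite X y t w).
Proof.
rewrite /=; case: ifP => _; last exact: subset_expand.
rewrite finset.subUset subset_expand.
exact: fintype.subset_trans (completers_subset _ _ _) (finset.subsetDl _ _).
Qed.

Lemma composite_sub_cplus y t w :
  bridging_target M y -> composite X y t w \subset cplus M.
Proof.
move=> hb; elim: t => [|t IHt].
  apply: fintype.subset_trans (bridging_sub_cplus hb).
  exact: finset.setUS (completers_subset _ _ _).
exact: fintype.subset_trans (composite_joining _ _ _) (expand_sub_cplus IHt).
Qed.

(* A stationary value C of the composite satisfies [expand C = C], since every
   member of [expand C :\: C] would eventually have completed. *)
Lemma composite_limit y w : bridging_target M y -> y <= first_mass X y w ->
  (forall i, i \in supporters M ->
    forall t0, exists2 t, (t0 <= t)%N & completes X t i w) ->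
  composite_reaches_cplus X y w.
Proof.
move=> hb yw io.
have [t0 stat] := nondecreasing_set_stationary (fun t => composite_mono y t w).
exists t0; set C := composite X y t0 w.
have CP : C \subset cplus M by exact: composite_sub_cplus.
have CE : C \subset everyone.
  exact: fintype.subset_trans CP (cplus_everyone M).
have fixC : expand C = C.
  apply/eqP; rewrite finset.eqEsubset subset_expand andbT.
  apply/fintype.subsetP => i iC; apply/negPn/negP => iNC.
  have iJ : i \in expand C :\: C by rewrite finset.inE iNC.
  have iS := fintype.subsetP (joining_supporters C) _ iJ.
  (* Asking for a round after [t0] makes it a successor t + 1 with t0 <= t, so the attempting set in
     it is computed from the stationary value C. *)
  have [[//|t] t0t it] := io i iS t0.+1.
  have : i \in composite X y t.+1 w.
    rewrite /= yw stat // finset.in_setU finset.in_set; apply/orP; right.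
    by rewrite iJ mem_set.
  by rewrite stat ?(ltnW t0t) // -/C (negbTE iNC).
have yC : y <= total_mass C.
  exact: le_trans yw (total_mass_subset (first_round_composite _ _ _) CE).
have BC : cminus M :|: same_date M y \subset C.
  rewrite finset.subUset; apply/andP; split.
    apply: fintype.subset_trans (first_round_composite y t0 w).
    exact: finset.subsetUl.
  (* C has mass at least y, so a member of B outside it would be protected on joining and hence lie
     in [expand C], which is C. *)
  apply/fintype.subsetP => i iB.
  have iS := fintype.subsetP (same_date_supporters M y) _ iB.
  have iCE : i |: C \subset everyone.
    by rewrite finset.subUset CE finset.sub1set finset.inE iS orbT.
  rewrite -fixC finset.in_setU; have [//|iNC] := boolP (i \in C).
  rewrite !finset.inE iNC iS /=; apply: (same_date_protected iB iCE).
    exact: finset.setU11.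
  exact: le_trans yC (total_mass_subset (finset.subsetUr _ _) iCE).
by rewrite -(bridging_expand_all hb BC CP) (expand_all_fixed fixC).
Qed.

(** Failing in n consecutive rounds from [t0] on has probability at most eps^n, which tends to 0. *)
Lemma negligible_never_completes i t0 : 0 < eps < 1 -> i \in supporters M ->
  P.-negligible [set w | forall t, (t0 <= t)%N -> ~ completes X t i w].
Proof.
move=> /andP[eps0 eps1] iS; set N := mkset _.
have mN : measurable N.
  rewrite (_ : N =
    \bigcap_(t in [set t | (t0 <= t)%N]) ~` completes X t i)%classic //.
  apply: bigcap_measurable => [|t _]; first by exists t0 => /=.
  exact/measurableC/completes_measurable.
apply/negligibleP => //; apply/eqP; rewrite eq_le measure_ge0 andbT.
have Nle n : (P N <= (eps ^+ n)%:E)%E.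
  pose s := [seq (t, i) | t <- iota t0 n].
  have p01 : 0 < 1 - eps < 1 by rewrite subr_gt0 eps1 ltrBlDr ltrDl.
  have := @prob_none_le _ _ _ P _ _ (fun k => completes X k.1 k.2) _
    (@completes_independent _ _ _ X) (1 - eps) _ s N mN.
  rewrite subKr size_map size_iota; apply.
  - by move=> [t j] /= jS; exact: completes_measurable.
  - by move=> [t j] /= jS; exact: completes_prob.
  - by move=> _ /mapP[t _ ->].
  - by rewrite map_inj_uniq ?iota_uniq // => t u [].
  - move=> w Nw _ /mapP[t + ->] /=.
    by rewrite mem_iota => /andP[t0t _]; exact: Nw.
rewrite -[leLHS]fineK ?fin_num_measure // lee_fin.
have /cvgrPdist_lt cv : (eps ^+ n @[n --> \oo] --> 0)%classic.
  by apply: cvg_expr; rewrite ger0_norm ?ltW.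
apply/ler_addgt0Pl => e /cv [n _ /(_ n (leqnn n))].
rewrite sub0r normrN ger0_norm ?exprn_ge0 ?(ltW eps0) // addr0 => ne.
apply/ltW/(le_lt_trans _ ne).
by have := Nle n; rewrite -[leLHS]fineK ?fin_num_measure // lee_fin.
Qed.

(** The exceptional set is covered by the null events of never completing from [t0] on, a countable
    union over pairs (i, t0) enumerated by [unpickle]; codes of no such pair contribute [set0]. *)
Lemma negligible_not_infinitely_often : 0 < eps < 1 ->
  P.-negligible [set w | ~ (forall i, i \in supporters M ->
    forall t0, exists2 t, (t0 <= t)%N & completes X t i w)]%classic.
Proof.
move=> heps.
pose F k := if @choice.unpickle (person M * nat)%type k is Some (i, t0) then
  if i \in supporters M then
    [set w | forall t, (t0 <= t)%N -> ~ completes X t i w]%classic else set0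
  else set0.
have negF : P.-negligible (\bigcup_k F k)%classic.
  apply: negligible_bigcup => k; rewrite /F.
  case: choice.unpickle => [[i t0]|]; last exact: negligible_set0.
  case: ifP => iS; last exact: negligible_set0.
  exact: negligible_never_completes.
apply: negligibleS negF => w /=.
move=> /existsNP[i] /not_implyP[iS] /existsNP[t0] never.
exists (choice.pickle (i, t0)) => //; rewrite /F choice.pickleK iS => t t0t it.
by apply: never; exists t.
Qed.

(** Once the target is reached, retries without deadline succeed almost surely, so only the
    scheduled round carries a risk. *)
Lemma prob_not_reaches_le y : 0 < eps < 1 -> bridging_target M y ->
  (P (~` composite_reaches_cplus X y)%classic
     <= P [set w | (first_mass X y w < y)%R]%classic)%E.
Proof.
move=> heps hb; have [Z [mZ PZ sZ]] := negligible_not_infinitely_often heps.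
apply: (@le_trans _ _ (P ([set w | (first_mass X y w < y)%R] `|` Z)%classic)).
  apply: le_measure; rewrite ?inE.
  - exact/measurableC/measurable_composite_reaches_cplus.
  - by apply: measurableU => //; exact: measurable_first_mass_lt.
  - move=> w nreach /=; have [|yw] := ltP (first_mass X y w) y; first by left.
    by right; apply: sZ => io; apply: nreach; exact: composite_limit.
apply: le_trans (measureU2 _ _ _) _ => //.
  exact: measurable_first_mass_lt.
by rewrite [X in (_ + X)%E](PZ : _ = 0%E) adde0.
Qed.

End Rounds.

(** * The scheduled round *)

Section FirstRound.
Variables (R : realType) (M : population R) (eps : R) (X : attempts M eps).
Variable y : R.

Local Notation P := (prob X).
Local Notation B := (same_date M y).
Local Notation n := #|same_date M y|.
Local Notation mB := (group_mass M y).
Local Notation Delta := (margin M eps y).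

(** Independence is stated for events indexed by round and person, so B enters the tail bounds as
    pairs in round 0. *)
Let first_attempts : seq (nat * person M) := [seq (0%N, i) | i <- enum B].

Let first_attempts_supporters :
  {subset first_attempts <= [pred k : nat * person M | k.2 \in supporters M]}.
Proof.
move=> _ /mapP[i + ->]; rewrite mem_enum.
exact: (fintype.subsetP (same_date_supporters M y)).
Qed.

Let first_attempts_uniq : uniq first_attempts.
Proof. by rewrite map_inj_uniq ?enum_uniq // => i j []. Qed.

Let first_attempts_size : size first_attempts = n.
Proof. by rewrite size_map -cardE. Qed.

Lemma first_massE w : first_mass X y w =
  yminus M + \sum_(i in B) mass i * \1_(completes X 0 i) w.
Proof.
rewrite /first_mass /first_round total_mass_setU; last first.
  apply: disjointWr (disjoint_cminus_same_date M y).
  exact: completers_subset.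
congr (_ + _); rewrite /total_mass big_mkcond [RHS]big_mkcond.
apply: eq_bigr => i _; rewrite finset.in_set indicE.
by case: (i \in B) => //=; case: (w \in _); rewrite ?mulr1 ?mulr0.
Qed.

Lemma expectation_first_mass :
  ('E_P[first_mass X y] = (yminus M + (1 - eps) * mB)%:E)%E.
Proof.
(* [completes] is only known to be measurable for supporters; the value [set0] off B makes every
   summand integrable. *)
pose E i := if i \in B then completes X 0 i else set0.
have mE i : measurable (E i).
  rewrite /E; case: ifP => [|_]; last exact: measurable0.
  move=> /(fintype.subsetP (same_date_supporters M y)).
  exact: completes_measurable.
have i1E i : P.-integrable setT (fun w => (\1_(E i) w)%:E).
  exact: integrable_indic.
have iE i : P.-integrable setT (fun w => (mass i)%:E * (\1_(E i) w)%:E)%E.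
  exact: integrableZl.
rewrite unlock.
have -> : (\int[P]_w (first_mass X y w)%:E = \int[P]_w ((yminus M)%:E +
    \sum_(i in B) (mass i)%:E * (\1_(E i) w)%:E))%E.
  apply: eq_integral => w _; rewrite first_massE EFinD; congr (_ + _)%E.
  by rewrite -sumEFin; apply: eq_bigr => i iB; rewrite EFinM /E iB.
rewrite integralD //; last 2 first.
- exact: finite_measure_integrable_cst.
- exact: integrable_sum.
rewrite integral_cst // [X in (_ * X)%E]probability_setT mule1 integral_sum //.
rewrite EFinD; congr (_ + _)%E.
rewrite mulrC /group_mass /total_mass mulr_suml -sumEFin.
apply: eq_bigr => i iB; rewrite integralZl // integral_indic ?setIT //.
rewrite EFinM; congr (_ * _)%E; rewrite /E iB; apply: completes_prob.
exact: (fintype.subsetP (same_date_supporters M y)).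
Qed.

Hypothesis heps : 0 < eps < 1.
Hypothesis hy : equal_mass_bridging_target M y.

Lemma group_mass_gt0 : 0 < mB.
Proof.
case: hy => _ _ n0 _; case/card_gt0P: (n0) => i iB.
rewrite /group_mass /total_mass (bigD1 i) //= ltr_wpDr ?sumr_ge0 //.
  move=> j /andP[/(fintype.subsetP (same_date_supporters M y)) jS _].
  by rewrite ltW // mass_gt0 // finset.inE jS orbT.
rewrite mass_gt0 // finset.inE.
by rewrite (fintype.subsetP (same_date_supporters M y) _ iB) orbT.
Qed.

Lemma first_mass_equal w : first_mass X y w = yminus M +
  mB / n%:R * \sum_(k <- first_attempts) \1_(completes X k.1 k.2) w.
Proof.
case: hy => _ _ _ mass_eq; rewrite first_massE big_map mulr_sumr big_enum /=.
by congr (_ + _); apply: eq_bigr => i iB; rewrite mass_eq.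
Qed.

(** As y - y^- equals (1 - eps) mB - Delta, dividing by the common mass mB / n turns a shortfall of
    mass into one of the count. *)
Let count_le w : first_mass X y w < y ->
  \sum_(k <- first_attempts) \1_(completes X k.1 k.2) w <=
    (size first_attempts)%:R * (1 - eps - Delta / mB).
Proof.
case: hy => _ _ n0 _; have mB0 := group_mass_gt0.
have nR0 : 0 < n%:R :> R by rewrite ltr0n.
rewrite first_mass_equal first_attempts_size -ltrBrDl => lt_y.
rewrite -(ler_pM2l (divr_gt0 mB0 nR0)).
apply: le_trans (ltW lt_y) _; rewrite le_eqVlt; apply/orP; left; apply/eqP.
rewrite /margin; field.
by rewrite !lt0r_neq0.
Qed.

Let eps01 : 0 < 1 - eps < 1.
Proof. by case/andP: heps => e0 e1; rewrite subr_gt0 e1 ltrBlDr ltrDl. Qed.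

Local Notation bound := (expR (- (2 * n%:R * Delta ^+ 2 / mB ^+ 2))).

Let boundE : bound =
  expR (- (2 * (size first_attempts)%:R * (Delta / mB) ^+ 2)).
Proof.
rewrite first_attempts_size expr_div_n.
by congr (expR (- _)); rewrite [RHS]mulrA.
Qed.

Lemma prob_first_mass_lt : 0 < Delta ->
  (P [set w | (first_mass X y w < y)%R]%classic <= bound%:E)%E.
Proof.
move=> D0; rewrite boundE.
apply: (@binomial_lower_tail _ _ _ P _ _ (fun k => completes X k.1 k.2) _
  (@completes_independent _ _ _ X) (1 - eps)) => //.
- by move=> [t j] /= jS; exact: completes_measurable.
- by move=> [t j] /= jS; exact: completes_prob.
- exact: measurable_first_mass_lt.
- by rewrite divr_ge0 ?ltW ?group_mass_gt0.
Qed.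

Lemma unprotected_prob_ge0 i : 0 <= unprotected_prob X y i.
Proof. by rewrite /unprotected_prob /cond_prob divr_ge0 ?fine_ge0. Qed.

(** Requirements in B are at most y, so being unprotected after completing forces a shortfall. The
    joint tail bound is then divided by the completion probability 1 - eps. *)
Lemma unprotected_prob_le i : 0 < Delta -> i \in B ->
  unprotected_prob X y i <= bound.
Proof.
move=> D0 iB; rewrite /unprotected_prob /cond_prob.
have BS := same_date_supporters M y; have iS := fintype.subsetP BS _ iB.
have -> : @completed_first R M eps X y i = completes X 0 i.
  by apply/seteqP; split => w; rewrite /completed_first /= finset.in_set iB /=;
    [move=> /set_mem|exact: mem_set].
rewrite completes_prob //= ler_pdivrMr; last by case/andP: eps01.
set U := (_ `&` _)%classic.
have mU : measurable U.
  apply: measurableI; last exact: completes_measurable.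
  have := measurable_completers X 0 BS
    (fun C => (i \in C) && ~~ protects (cminus M :|: C) i).
  by congr measurable; apply/seteqP; split => w /andP.
have := @binomial_lower_tail_joint _ _ _ P _ _ (fun k => completes X k.1 k.2) _
  (@completes_independent _ _ _ X) (1 - eps) eps01 _ (0%N, i) first_attempts U
  (Delta / mB) mU first_attempts_supporters first_attempts_uniq.
rewrite -boundE => tail.
rewrite -lee_fin fineK ?fin_num_measure // mulrC; apply: tail.
- by move=> [t j] /= jS; exact: completes_measurable.
- by move=> [t j] /= jS; exact: completes_prob.
- by apply: map_f; rewrite mem_enum.
- by rewrite divr_ge0 ?ltW ?group_mass_gt0.
move=> w [[iC unprot] iw]; split => //; apply: count_le; rewrite ltNge.
apply: contra unprot => le_y; apply: same_date_protected le_y => //.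
- rewrite finset.subUset cminus_everyone.
  apply: fintype.subset_trans (finset.subsetUr _ _).
  exact: fintype.subset_trans (completers_subset _ _ _) BS.
- by rewrite finset.in_setU iC orbT.
Qed.

End FirstRound.

Theorem proposition1 (R : realType) (M : population R) (eps : R)
    (X : attempts M eps) (y : R)
    (heps : 0 < eps < 1) (hy : equal_mass_bridging_target M y) :
  let B := same_date M y in
  let n := #|B| in
  let mB := group_mass M y in
  let Delta := margin M eps y in
  let P := prob X in
  let bound := expR (- (2 * n%:R * Delta ^+ 2 / mB ^+ 2)) in
  (* (i) *)
  [/\ ('E_P[first_mass X y] = (yminus M + (1 - eps) * mB)%:E)%E,
      yminus M + (1 - eps) * mB = y + Delta &
      (y%:E <= 'E_P[first_mass X y])%E <->
        eps * (y - yminus M) <= (1 - eps) * slack M y]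
  /\
  (* (ii) *)
  (0 < Delta ->
    [/\ forall i, i \in B -> unprotected_prob X y i <= bound,
        (P [set w | (first_mass X y w < y)%R]%classic
           <= bound%:E)%E,
        forall (r : person M -> R) (rmin : R),
          is_min_over B r rmin -> 0 < rmin ->
          mB ^+ 2 / (2 * Delta ^+ 2) * ln (1 / rmin) <= n%:R ->
          forall i, i \in B -> acceptable X y r i &
        forall (Ms : nat -> population R) (epss : nat -> R)
            (Xs : forall k, attempts (Ms k) (epss k)) (ys : nat -> R)
            (i : forall k, person (Ms k)),
          (forall k, 0 < epss k < 1) ->
          (forall k, equal_mass_bridging_target (Ms k) (ys k)) ->
          (forall k, group_mass (Ms k) (ys k) = mB) ->
          (forall k, margin (Ms k) (epss k) (ys k) = Delta) ->
          (#|same_date (Ms k) (ys k)| @[k --> \oo] --> \oo)%classic ->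
          (forall k, i k \in same_date (Ms k) (ys k)) ->
          (unprotected_prob (Xs k) (ys k) (i k) @[k --> \oo] --> (0 : R))%classic])
  /\
  (* (iii) *)
  (0 < Delta ->
    [/\ forall Rc : {set person M}, Rc \subset B ->
          y <= total_mass (cminus M :|: Rc) ->
          forall i, i \in B :\: Rc ->
          forall C A : {set person M}, coalition C ->
            cminus M :|: Rc \subset C -> A \subset supporters M -> i \in A ->
            protects (C :|: A) i,
        forall C : {set person M},
          cminus M :|: B \subset C -> C \subset cplus M ->
          expand_all C = cplus M,
        forall w, y <= first_mass X y w -> forall t,
          B \subset composite X y t w ->
          expand_all (composite X y t w) = cplus M,
        forall w, y <= first_mass X y w -> forall t i,
          i \in composite X y t.+1 w :\: composite X y t w ->
          protects (composite X y t.+1 w) i &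
        (P (~` composite_reaches_cplus X y)%classic
           <= bound%:E)%E]).
Proof.
move=> B n mB Delta P bound; have [_ hb _ _] := hy.
have mB0 : 0 < mB := group_mass_gt0 hy.
split; [|split].
- split; first exact: expectation_first_mass.
    by rewrite /Delta /margin -/mB; ring.
  rewrite expectation_first_mass lee_fin /slack -/mB.
  by split=> h; lra.
- move=> D0; split.
  + by move=> i iB; exact: unprotected_prob_le.
  + exact: prob_first_mass_lt.
  + move=> r rmin [_ rmin_le] rmin0 n_ge i iB.
    rewrite /acceptable (le_trans (unprotected_prob_le X heps hy D0 iB)) //.
    apply: (le_trans _ (rmin_le i iB)); rewrite -/B -/n -/mB -/Delta.
    (* After taking logarithms the claim is - ln rmin <= 2 n Delta^2 / mB^2, a rescaling of the
       hypothesis on n. *)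
    rewrite -[leRHS]lnK ?posrE // ler_expR lerNl.
    move: n_ge; rewrite div1r lnV ?posrE // -ler_pdivlMl; last first.
      by rewrite divr_gt0 ?mulr_gt0 ?exprn_gt0.
    rewrite invf_div => /le_trans; apply; rewrite le_eqVlt; apply/orP; left.
    by apply/eqP; ring.
  + move=> Ms epss Xs ys i heps_k hy_k mB_k D_k n_k iB_k.
    (* Group mass and margin are fixed along the refinements, so the bound varies with [k] only
       through the group size. *)
    pose u k : R := expR (- ((2 * Delta ^+ 2 / mB ^+ 2) *
      #|same_date (Ms k) (ys k)|%:R)).
    have u0 : (u k @[k --> \oo] --> (0 : R))%classic.
      apply: (cvg_comp (fun k => 2 * Delta ^+ 2 / mB ^+ 2 *
        #|same_date (Ms k) (ys k)|%:R) (fun x => expR (- x)) _ (@cvgr_expR R)).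
      have c0 : 0 < 2 * Delta ^+ 2 / mB ^+ 2.
        by rewrite divr_gt0 ?mulr_gt0 ?exprn_gt0.
      apply/cvgryPge => A; apply: (n_k (fun m => A <= _ * m%:R)).
      near=> m; rewrite -ler_pdivrMl //; near: m; exact: nbhs_infty_ger.
    apply: (squeeze_cvgr _ (cvg_cst 0) u0); near=> k.
    rewrite unprotected_prob_ge0 /=.
    have := unprotected_prob_le (Xs k) (heps_k k) (hy_k k) _ (iB_k k).
    rewrite mB_k D_k => /(_ D0) /le_trans; apply.
    by rewrite ler_expR lerN2 le_eqVlt; apply/orP; left; apply/eqP; ring.
- move=> D0; split.
  + move=> Rc RcB y_le i; rewrite finset.inE => /andP[_ iB] C A cC RC AS iA.
    have CE : C :|: A \subset vanguard M :|: supporters M.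
      case/andP: cC => _ CE; rewrite finset.subUset CE.
      exact: fintype.subset_trans AS (finset.subsetUr _ _).
    apply: (same_date_protected iB CE); first by rewrite finset.inE iA orbT.
    apply: le_trans y_le (total_mass_subset _ CE).
    exact: fintype.subset_trans RC (finset.subsetUl _ _).
  + by move=> C; exact: bridging_expand_all.
  + move=> w _ t BC.
    apply: bridging_expand_all hb _ (composite_sub_cplus _ _ hb).
    rewrite finset.subUset BC andbT.
    apply: fintype.subset_trans (first_round_composite y t w).
    exact: finset.subsetUl.
  + move=> w _ t i; rewrite finset.inE => /andP[iNC iC].
    have CE : composite X y t.+1 w \subset vanguard M :|: supporters M.
      exact: fintype.subset_trans (composite_sub_cplus _ _ hb) (cplus_everyone _).
    (* A newcomer would be protected joining the previous coalition alone; those who complete with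
       her only add mass. *)
    have := fintype.subsetP (composite_joining y t w) _ iC.
    rewrite finset.in_setU (negbTE iNC) finset.in_set /= => /andP[_].
    apply: protects_subset CE.
    by rewrite finset.subUset finset.sub1set iC composite_mono.
  + apply: le_trans (prob_not_reaches_le X heps hb) _.
    exact: prob_first_mass_lt.
Unshelve. all: by end_near.
Qed.
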